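(* Let $n\ge2$ and $\eta>0$. Count each chi-squared (or Gamma) draw as one Gamma-equivalent draw and each Beta draw as two Gamma-equivalent draws (normals contribute zero). Then: (i) the numbers of scalar distribution calls made by the four Cholesky-factor samplers of $\operatorname{LKJ}_n(\eta)$ described in the context are: - extended onion: $\frac{n(n-1)}{2}-1$ normal, $n-1$ Beta, $0$ chi-squared; $2(n-1)$ Gamma-equivalent; - C-vine, conventional: $0$ normal, $\frac{n(n-1)}{2}$ Beta, $0$ chi-squared; $n(n-1)$ Gamma-equivalent; - C-vine, tail representation: $\frac{n(n-1)}{2}$ normal, $0$ Beta, $\frac{n(n-1)}{2}$ chi-squared; $\frac{n(n-1)}{2}$ Gamma-equivalent; - normalized Bartlett: $\frac{n(n-1)}{2}$ normal, $0$ Beta, $n-1$ chi-squared; $n-1$ Gamma-equivalent. (ii) Let $c_N>0$ and $c_\Gamma>0$ be the costs of a standard normal draw and of a Gamma-equivalent draw, let $r=c_\Gamma/c_N$, and define the model costs $$ \widetilde{T}_{\operatorname{onion}}(n)=\Bigl(\tfrac{n(n-1)}{2}-1\Bigr)c_N+2(n-1)c_\Gamma,\qquad \widetilde{T}_{\operatorname{vine}}(n)=n(n-1)c_\Gamma, $$ $$ \widetilde{T}_{\operatorname{vine}}^{\operatorname{tail}}(n)=\tfrac{n(n-1)}{2}(c_N+c_\Gamma),\qquad \widetilde{T}_{\operatorname{Bartlett}}(n)=\tfrac{n(n-1)}{2}c_N+(n-1)c_\Gamma . $$ Then the speed ratios relative to normalized Bartlett, $S=\widetilde{T}/\widetilde{T}_{\operatorname{Bartlett}}$,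 are $$ S_{\operatorname{onion}}(n;r)=\frac{n+4r-\frac{2}{n-1}}{n+2r},\qquad S_{\operatorname{vine}}(n;r)=\frac{2rn}{n+2r},\qquad S_{\operatorname{vine}}^{\operatorname{tail}}(n;r)=\frac{(1+r)n}{n+2r}, $$ so that $S_{\operatorname{onion}}\to1$, $S_{\operatorname{vine}}\to2r$, and $S_{\operatorname{vine}}^{\operatorname{tail}}\to1+r$ as $n\to\infty$.
   Context: $\operatorname{LKJ}_n(\eta)$ is the distribution on $n\times n$ correlation matrices with density proportional to $\det(C)^{\eta-1}$. Each sampler outputs a lower-triangular $n\times n$ factor $L$ with $L_{11}=1$; only scalar draws of random variates are counted. $\operatorname{Gamma}(\alpha,\theta)$ has shape $\alpha$ and scale $\theta$, and $\chi^2_a\equiv\operatorname{Gamma}(a/2,2)$. A Beta draw counts as two Gamma-equivalents via the representation $\operatorname{Beta}(\alpha,\beta)\equiv X/(X+Y)$ with independent $X\sim\operatorname{Gamma}(\alpha,1)$, $Y\sim\operatorname{Gamma}(\beta,1)$. The four samplers: Extended onion: row 2 is generated from a single Beta draw $V\sim\operatorname{Beta}(\beta_0,\beta_0)$, $\beta_0=\eta+(n-2)/2$, by $L_{21}=2V-1$, $L_{22}=(1-L_{21}^2)^{1/2}$; for each row $i=3,\ldots,n$ one draws one Beta variate $R_i^2\sim\operatorname{Beta}(\frac{i-1}{2},\eta+\frac{n-i}{2})$ and $i-1$ standard normals forming $Z_i$, sets $U_i=Z_i/\|Z_i\|$, $L_{i,1:i-1}=R_iU_i^\prime$, $L_{ii}=(1-R_i^2)^{1/2}$.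 C-vine, conventional: for each pair $1\le j<i\le n$ one draws one Beta variate $V\sim\operatorname{Beta}(\beta_j,\beta_j)$, $\beta_j=\eta+(n-1-j)/2$, and sets the partial correlation $\rho_{ij}=2V-1$ (all independent); then $L_{ij}=\rho_{ij}\prod_{k<j}(1-\rho_{ik}^2)^{1/2}$ and $L_{ii}=\prod_{k<i}(1-\rho_{ik}^2)^{1/2}$, deterministically. C-vine, tail representation: same, except that each $\rho_{ij}=Z/(Z^2+Y)^{1/2}$ with a fresh standard normal $Z$ and a fresh independent $Y\sim\operatorname{Gamma}(\beta_j,2)=\chi^2_{2\beta_j}$. Normalized Bartlett: for each row $i=2,\ldots,n$ one draws $i-1$ standard normals forming $Z_i$ and one independent $G_i\sim\chi^2_{n+2\eta-i}$, and sets $S_i=(Z_i^\prime Z_i+G_i)^{1/2}$, $L_{i,1:i-1}=Z_i^\prime/S_i$, $L_{ii}=G_i^{1/2}/S_i$. *)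

(* Defs.v *)
From mathcomp Require Import all_boot all_order all_algebra.
From mathcomp Require Import all_classical reals topology normedtype sequences.

Set Implicit Arguments.
Unset Strict Implicit.
Unset Printing Implicit Defensive.

Import Order.TTheory GRing.Theory Num.Theory.
Local Open Scope ring_scope.

(* One call to a scalar random-variate generator: a standard normal,
   Beta(a, b), or Gamma(shape, scale). *)
Inductive call (R : Type) : Type :=
  | Normal
  | Beta of R & R
  | Gamma of R & R.
Arguments Normal {R}.

(* A sampling algorithm: it either returns a value, or makes one fresh call,
   independent of the earlier ones, and continues with the variate it got. *)
Inductive sampler (R A : Type) : Type :=
  | Ret of A
  | Draw of call R & (R -> sampler R A).
Arguments Ret {R A} _.
Arguments Draw {R A} _ _.

Fixpoint bind (R A B : Type) (p : sampler R A) (f : A -> sampler R B)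
    : sampler R B :=
  match p with
  | Ret a => f a
  | Draw c k => Draw c (fun x => bind (k x) f)
  end.

Notation "x <-- p ;; q" := (bind p (fun x => q))
  (at level 100, p at next level, right associativity).

Definition draw (R : Type) (c : call R) : sampler R R := Draw c Ret.

Fixpoint for_each (R I B : Type) (s : seq I) (f : I -> sampler R B)
    : sampler R (seq B) :=
  match s with
  | [::] => Ret [::]
  | i :: s' => b <-- f i ;; bs <-- for_each s' f ;; Ret (b :: bs)
  end.

(* The calls made by p, in order, when the successive variates it receives
   are w 0, w 1, w 2, and so on. *)
Fixpoint calls (R A : Type) (p : sampler R A) (w : nat -> R) : seq (call R) :=
  match p with
  | Ret _ => [::]
  | Draw c k => c :: calls (k (w 0%N)) (fun m => w m.+1)
  end.

Section Counting.
Variable R : realType.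
Implicit Types (c : call R).

Definition chi_squared (a : R) : call R := Gamma (a / 2) 2.

Definition is_normal c := if c is Normal then true else false.

Definition is_beta c := if c is Beta _ _ then true else false.

(* Gamma(k, 2) is the chi-squared distribution with 2k degrees of freedom. *)
Definition is_chi_squared c := if c is Gamma _ s then s == 2 else false.

(* Beta(a, b) is X / (X + Y) with independent X ~ Gamma(a, 1) and
   Y ~ Gamma(b, 1). *)
Definition gamma_equivalents c : nat :=
  match c with
  | Normal => 0
  | Beta _ _ => 2
  | Gamma _ _ => 1
  end.

(* The counts hold on every run, whatever variates are drawn. *)
Definition makes_calls (A : Type) (p : sampler R A)
    (normals betas chi_squareds gamma_equivs : nat) : Prop :=
  forall w : nat -> R,
    [/\ count is_normal (calls p w) = normals,
        count is_beta (calls p w) = betas,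
        count is_chi_squared (calls p w) = chi_squareds &
        \sum_(c <- calls p w) gamma_equivalents c = gamma_equivs]%N.

End Counting.

(* In this section the row and column numbers i, j, k are 1-based, as in the
   parameters of the distributions.  Row i of a factor is computed as the list
   of its i leading entries. *)
Section Samplers.
Variable R : realType.
Variables (n : nat) (eta : R).

(* The n x n lower-triangular matrix with first row (1, 0, ..., 0) whose
   rows 2, ..., n are given by rows. *)
Definition factor (rows : seq (seq R)) : 'M[R]_n :=
  \matrix_(i < n, j < n) nth 0 (nth [::] ([:: 1] :: rows) i) j.

Definition normal_vector (m : nat) : sampler R (seq R) :=
  for_each (iota 1 m) (fun _ => draw Normal).

Definition sq_norm (z : seq R) : R := \sum_(x <- z) x ^+ 2.

Definition onion_row2 : sampler R (seq R) :=
  let beta0 := eta + (n%:R - 2) / 2 in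
  v <-- draw (Beta beta0 beta0) ;;
  let l21 := 2 * v - 1 in
  Ret [:: l21; Num.sqrt (1 - l21 ^+ 2)].

Definition onion_row (i : nat) : sampler R (seq R) :=
  r2 <-- draw (Beta ((i%:R - 1) / 2) (eta + (n%:R - i%:R) / 2)) ;;
  z <-- normal_vector (i - 1) ;;
  let u := [seq x / Num.sqrt (sq_norm z) | x <- z] in
  Ret (rcons [seq Num.sqrt r2 * x | x <- u] (Num.sqrt (1 - r2))).

Definition extended_onion : sampler R 'M[R]_n :=
  row2 <-- onion_row2 ;;
  rows <-- for_each (iota 3 (n - 2)) onion_row ;;
  Ret (factor (row2 :: rows)).

Definition vine_beta (j : nat) : R := eta + (n%:R - 1 - j%:R) / 2.

(* rho lists the partial correlations rho_{i,1}, ..., rho_{i,i-1}. *)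
Definition vine_row (i : nat) (rho : seq R) : seq R :=
  let tail (j : nat) := \prod_(1 <= k < j) Num.sqrt (1 - nth 0 rho k.-1 ^+ 2) in
  rcons [seq nth 0 rho j.-1 * tail j | j <- iota 1 (i - 1)] (tail i).

Definition c_vine (partial_correlation : nat -> sampler R R)
    : sampler R 'M[R]_n :=
  rows <-- for_each (iota 2 (n - 1)) (fun i =>
    rho <-- for_each (iota 1 (i - 1)) partial_correlation ;;
    Ret (vine_row i rho)) ;;
  Ret (factor rows).

Definition c_vine_conventional : sampler R 'M[R]_n :=
  c_vine (fun j =>
    v <-- draw (Beta (vine_beta j) (vine_beta j)) ;;
    Ret (2 * v - 1)).

Definition c_vine_tail : sampler R 'M[R]_n :=
  c_vine (fun j =>
    z <-- draw Normal ;;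
    y <-- draw (Gamma (vine_beta j) 2) ;;
    Ret (z / Num.sqrt (z ^+ 2 + y))).

Definition bartlett_row (i : nat) : sampler R (seq R) :=
  z <-- normal_vector (i - 1) ;;
  g <-- draw (chi_squared (n%:R + 2 * eta - i%:R)) ;;
  let s := Num.sqrt (sq_norm z + g) in
  Ret (rcons [seq x / s | x <- z] (Num.sqrt g / s)).

Definition normalized_bartlett : sampler R 'M[R]_n :=
  rows <-- for_each (iota 2 (n - 1)) bartlett_row ;;
  Ret (factor rows).

End Samplers.

(* cN and cG are the costs of a standard normal draw and of a
   Gamma-equivalent draw. *)
Section Costs.
Variable R : realType.
Variables cN cG : R.

Definition T_onion (n : nat) : R :=
  (n%:R * (n%:R - 1) / 2 - 1) * cN + 2 * (n%:R - 1) * cG.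

Definition T_vine (n : nat) : R := n%:R * (n%:R - 1) * cG.

Definition T_vine_tail (n : nat) : R :=
  n%:R * (n%:R - 1) / 2 * (cN + cG).

Definition T_bartlett (n : nat) : R :=
  n%:R * (n%:R - 1) / 2 * cN + (n%:R - 1) * cG.

Definition S_onion (n : nat) : R := T_onion n / T_bartlett n.

Definition S_vine (n : nat) : R := T_vine n / T_bartlett n.

Definition S_vine_tail (n : nat) : R := T_vine_tail n / T_bartlett n.

End Costs.

(* Main.v *)
Require Import Defs.
From mathcomp Require Import all_boot all_order all_algebra.
From mathcomp Require Import all_classical reals topology normedtype sequences.
From mathcomp Require Import ring lra.

Set Implicit Arguments.
Unset Strict Implicit.
Unset Printing Implicit Defensive.

Import Order.TTheory GRing.Theory Num.Theory.
Import numFieldNormedType.Exports.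
Local Open Scope classical_set_scope.
Local Open Scope ring_scope.

(** Part (i).  The number of calls a sampler makes does not depend on the
    variates that it receives, so counts are additive along sequencing: the
    calls of [bind p f] are those of [p] followed by those of [f x] for some
    [x] ([calls_bind]), and a loop adds up the counts of its iterations
    ([makes_calls_for_each]).  Row [i] of a factor needs [i - 1] draws of the
    kinds made once per entry and one draw of the kinds made once per row, so
    the totals are the number [n - 1] of rows and
    [1 + 2 + ... + (n - 1) = 'C(n, 2) = n (n - 1) / 2] ([sum_row_lengths]).
    The onion loses one normal because its row 2 is a single Beta draw.

    Part (ii).  The Bartlett cost is [cN (n - 1) (n + 2 r) / 2], so cancelling
    [cN (n - 1) / 2] gives the three closed forms.  Each of them is its limit
    plus [e n / (n + 2 r)], where [e n] is [2 r - 2 / (n - 1)] for the onion,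
    [- 4 r ^ 2] for the vine and [- 2 r (1 + r)] for its tail variant.  The
    sequence [e] converges and [1 / (n + 2 r)] tends to 0 ([cvg_inv_natD]). *)

Section Calls.
Variable R : realType.

(** The suffix of the variate stream on which the continuation runs is the
    one left over by [p]; it is existentially quantified because counts that
    hold on every stream need not know it. *)
Lemma calls_bind (A B : Type) (p : sampler R A) (f : A -> sampler R B)
    (w : nat -> R) :
  exists (x : A) (w' : nat -> R),
    calls (bind p f) w = calls p w ++ calls (f x) w'.
Proof.
elim: p w => [x|c k IHk] w /=; first by exists x, w.
by have [x [w' ->]] := IHk (w 0%N) (fun m => w m.+1); exists x, w'.
Qed.

Lemma makes_calls_ret (A : Type) (x : A) :
  makes_calls (Ret x : sampler R A) 0 0 0 0.
Proof. by move=> w; rewrite big_nil. Qed.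

Lemma makes_calls_draw (c : call R) :
  makes_calls (draw c) (is_normal c) (is_beta c) (is_chi_squared c)
    (gamma_equivalents c).
Proof. by move=> w; rewrite /= !addn0 big_seq1. Qed.

Lemma makes_calls_bind (A B : Type) (p : sampler R A) (f : A -> sampler R B)
    (a b c d a' b' c' d' : nat) :
  makes_calls p a b c d -> (forall x, makes_calls (f x) a' b' c' d') ->
  makes_calls (bind p f) (a + a') (b + b') (c + c') (d + d').
Proof.
move=> pP fP w; have [x [w' ->]] := calls_bind p f w.
have [<- <- <- <-] := pP w; have [<- <- <- <-] := fP x w'.
by rewrite !count_cat big_cat.
Qed.

Lemma makes_calls_bind_ret (A B : Type) (p : sampler R A) (f : A -> B)
    (a b c d : nat) :
  makes_calls p a b c d -> makes_calls (x <-- p ;; Ret (f x)) a b c d.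
Proof.
move=> pP; have := makes_calls_bind pP (fun x => makes_calls_ret (f x)).
by rewrite !addn0.
Qed.

Lemma makes_calls_for_each (I B : Type) (s : seq I) (f : I -> sampler R B)
    (a b c d : I -> nat) :
  (forall i, makes_calls (f i) (a i) (b i) (c i) (d i)) ->
  makes_calls (for_each s f) (\sum_(i <- s) a i) (\sum_(i <- s) b i)
    (\sum_(i <- s) c i) (\sum_(i <- s) d i).
Proof.
move=> fP; elim: s => [|i s IHs]; first by rewrite !big_nil; apply: makes_calls_ret.
rewrite !big_cons; apply: makes_calls_bind => // x.
exact: makes_calls_bind_ret.
Qed.

Lemma makes_calls_repeat (I B : Type) (s : seq I) (f : I -> sampler R B)
    (a b c d : nat) :
  (forall i, makes_calls (f i) a b c d) ->
  makes_calls (for_each s f) (size s * a) (size s * b) (size s * c)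
    (size s * d).
Proof.
move=> fP; have := makes_calls_for_each s fP.
by rewrite !big_const_seq !count_predT !iter_addn_0 ![(_ * size s)%N]mulnC.
Qed.

End Calls.

Lemma sum_row_lengths (n : nat) :
  (0 < n)%N -> (\sum_(i <- iota 2 (n - 1)) (i - 1) = 'C(n, 2))%N.
Proof.
case: n => // n _; rewrite subn1 -bin2_sum big_nat_recl //= add0n.
rewrite (iotaDl 1 1) big_map -{1}[n]subn0 (iotaDl 1 0) big_map.
by apply: eq_bigr => i _; rewrite subnE.
Qed.

Section SamplerCounts.
Variables (R : realType) (n : nat) (eta : R).
Hypothesis n_ge2 : (2 <= n)%N.

Lemma makes_calls_normal_vector (m : nat) :
  makes_calls (normal_vector R m) m 0 0 0.
Proof.
have := makes_calls_repeat (iota 1 m) (fun=> makes_calls_draw (@Normal R)).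
by rewrite size_iota muln1 !muln0.
Qed.

Lemma makes_calls_onion_row (i : nat) :
  makes_calls (onion_row n eta i) (i - 1) 1 0 2.
Proof.
apply: (makes_calls_bind (makes_calls_draw _)) => r2.
exact/makes_calls_bind_ret/makes_calls_normal_vector.
Qed.

Lemma makes_calls_extended_onion :
  makes_calls (extended_onion n eta) ('C(n, 2) - 1) (n - 1) 0 (2 * (n - 1)).
Proof.
have row2P : makes_calls (onion_row2 n eta) 0 1 0 2.
  exact/makes_calls_bind_ret/makes_calls_draw.
pose total (h : nat -> nat) := (\sum_(i <- iota 3 (n - 2)) h i)%N.
have : makes_calls (extended_onion n eta) (0 + total (subn^~ 1%N))
    (1 + total (fun=> 1%N)) (0 + total (fun=> 0%N)) (2 + total (fun=> 2%N)).
  apply: makes_calls_bind row2P _ => row2.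
  exact/makes_calls_bind_ret/makes_calls_for_each/makes_calls_onion_row.
(* The loop starts at row 3: row 2, of length 1, accounts for the [- 1]. *)
have -> : ('C(n, 2) - 1 = \sum_(i <- iota 3 (n - 2)) (i - 1))%N.
  rewrite -(sum_row_lengths (ltnW n_ge2)) -[(n - 1)%N]prednK ?subn_gt0 //=.
  by rewrite big_cons addKn -subn1 -subnDA.
rewrite {}/total !big_const_seq !count_predT !iter_addn_0 size_iota.
rewrite (_ : n - 1 = 1 + (n - 2))%N; first by rewrite mulnDr muln1 mul1n mul0n.
by rewrite addnC addn1 -subSn.
Qed.

Lemma makes_calls_c_vine (pc : nat -> sampler R R) (a b c d : nat) :
  (forall j, makes_calls (pc j) a b c d) ->
  makes_calls (c_vine n pc) ('C(n, 2) * a) ('C(n, 2) * b) ('C(n, 2) * c)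
    ('C(n, 2) * d).
Proof.
move=> pcP; apply: makes_calls_bind_ret.
rewrite -(sum_row_lengths (ltnW n_ge2)) !big_distrl /=.
apply: makes_calls_for_each => i; apply: makes_calls_bind_ret.
by have := makes_calls_repeat (iota 1 (i - 1)) pcP; rewrite size_iota.
Qed.

Lemma makes_calls_c_vine_conventional :
  makes_calls (c_vine_conventional n eta) 0 'C(n, 2) 0 (n * (n - 1)).
Proof.
have := @makes_calls_c_vine (fun j =>
  v <-- draw (Beta (vine_beta n eta j) (vine_beta n eta j)) ;;
  Ret (2 * v - 1)) 0 1 0 2.
have -> : ('C(n, 2) * 2 = n * (n - 1))%N.
  by rewrite [LHS]mulnC mul_bin_left bin1 mulnC.
rewrite muln1 muln0; apply=> j.
exact/makes_calls_bind_ret/makes_calls_draw.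
Qed.

Lemma makes_calls_c_vine_tail :
  makes_calls (c_vine_tail n eta) 'C(n, 2) 0 'C(n, 2) 'C(n, 2).
Proof.
have := @makes_calls_c_vine (fun j => z <-- draw Normal ;;
  y <-- draw (Gamma (vine_beta n eta j) 2) ;;
  Ret (z / Num.sqrt (z ^+ 2 + y))) 1 0 1 1.
rewrite !muln1 muln0; apply=> j.
apply: (makes_calls_bind (makes_calls_draw _)) => z.
apply: makes_calls_bind_ret.
by have := makes_calls_draw (Gamma (vine_beta n eta j) 2); rewrite /= eqxx.
Qed.

Lemma makes_calls_normalized_bartlett :
  makes_calls (normalized_bartlett n eta) 'C(n, 2) 0 (n - 1) (n - 1).
Proof.
apply: makes_calls_bind_ret.
have rowP i : makes_calls (bartlett_row n eta i) (i - 1) 0 1 1.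
  rewrite -[(i - 1)%N]addn0.
  apply: (makes_calls_bind (makes_calls_normal_vector _)) => z.
  apply: makes_calls_bind_ret.
  have := makes_calls_draw (chi_squared (n%:R + 2 * eta - i%:R)).
  by rewrite /= eqxx.
have := makes_calls_for_each (iota 2 (n - 1)) rowP.
rewrite sum_row_lengths ?(ltnW n_ge2) //.
by rewrite !big_const_seq !count_predT !iter_addn_0 size_iota mul1n.
Qed.

End SamplerCounts.

Section SpeedRatios.
Variables (R : realType) (cN cG : R).
Hypotheses (cN_gt0 : 0 < cN) (cG_gt0 : 0 < cG).
Let r := cG / cN.

Lemma speed_ratios (n : nat) : (2 <= n)%N ->
  [/\ S_onion cN cG n = (n%:R + 4 * r - 2 / (n%:R - 1)) / (n%:R + 2 * r),
      S_vine cN cG n = (2 * r * n%:R) / (n%:R + 2 * r) &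
      S_vine_tail cN cG n = ((1 + r) * n%:R) / (n%:R + 2 * r)].
Proof.
move=> n_ge2; have n1 : (1 < n%:R :> R) by rewrite ltr1n.
have n1_neq0 : n%:R - 1 != 0 :> R by rewrite subr_eq0 gt_eqF.
have cN_neq0 : cN != 0 by rewrite gt_eqF.
have d_neq0 : n%:R * cN + 2 * cG != 0 by rewrite gt_eqF // addr_gt0 ?mulr_gt0 // (lt_trans ltr01).
have TE : T_bartlett cN cG n = (n%:R - 1) / 2 * (n%:R * cN + 2 * cG).
  by rewrite /T_bartlett; field.
rewrite /S_onion /S_vine /S_vine_tail TE /T_onion /T_vine /T_vine_tail /r.
split; field; do ?[apply/andP; split] => //.
Qed.

Lemma cvg_inv_natD (d : R) : (n%:R + d)^-1 @[n --> \oo] --> (0 : R).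
Proof.
apply/gtr0_cvgV0.
  by near=> n; rewrite -ltrBlDr sub0r; near: n; exact: nbhs_infty_gtr.
apply/cvgryPge => A.
by near=> n; rewrite -lerBlDr; near: n; exact: nbhs_infty_ger.
Unshelve. all: by end_near. Qed.

Lemma cvg_speed_ratios :
  [/\ S_onion cN cG n @[n --> \oo] --> (1 : R),
      S_vine cN cG n @[n --> \oo] --> 2 * r &
      S_vine_tail cN cG n @[n --> \oo] --> 1 + r].
Proof.
have r_gt0 : 0 < r by rewrite divr_gt0.
have inv_cvg := cvg_inv_natD (2 * r).
(* The error [e n / (n + 2 r)] vanishes whatever the limit [a] of [e]; the
   closed forms hold from 2 on, which is enough for a limit. *)
have cvg_split (S e : nat -> R) (l a : R) : e n @[n --> \oo] --> a ->
    (forall n, (2 <= n)%N -> S n = l + e n * (n%:R + 2 * r)^-1) ->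
    S n @[n --> \oo] --> l.
  move=> e_cvg SE; rewrite -[l]addr0 -[0](mulr0 a).
  apply: cvg_trans (cvgD (cvg_cst l) (cvgM e_cvg inv_cvg)).
  by apply: near_eq_cvg; exists 2%N => // n /= /SE.
split.
- apply: (@cvg_split _ (fun n => 2 * r - 2 * (n%:R - 1)^-1) _ (2 * r - 2 * 0)).
    apply: cvgB; first exact: cvg_cst.
    exact: cvgM (cvg_cst _) (cvg_inv_natD (- 1)).
  move=> n n_ge2; have [-> _ _] := speed_ratios n_ge2.
  have n1 : (1 < n%:R :> R) by rewrite ltr1n.
  by field; rewrite !gt_eqF; lra.
- apply: (@cvg_split _ (fun=> - (4 * r ^+ 2)) _ _ (cvg_cst _)).
  move=> n n_ge2; have [_ -> _] := speed_ratios n_ge2.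
  have n1 : (1 < n%:R :> R) by rewrite ltr1n.
  by field; rewrite gt_eqF; lra.
- apply: (@cvg_split _ (fun=> - (2 * r * (1 + r))) _ _ (cvg_cst _)).
  move=> n n_ge2; have [_ _ ->] := speed_ratios n_ge2.
  have n1 : (1 < n%:R :> R) by rewrite ltr1n.
  by field; rewrite gt_eqF; lra.
Qed.

End SpeedRatios.

Theorem proposition4 (R : realType) :
  (forall (n : nat) (eta : R), (2 <= n)%N -> 0 < eta ->
     [/\ makes_calls (extended_onion n eta)
           ((n * (n - 1)) %/ 2 - 1)%N (n - 1)%N 0%N (2 * (n - 1))%N,
         makes_calls (c_vine_conventional n eta)
           0%N ((n * (n - 1)) %/ 2)%N 0%N (n * (n - 1))%N,
         makes_calls (c_vine_tail n eta)
           ((n * (n - 1)) %/ 2)%N 0%N ((n * (n - 1)) %/ 2)%N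
           ((n * (n - 1)) %/ 2)%N &
         makes_calls (normalized_bartlett n eta)
           ((n * (n - 1)) %/ 2)%N 0%N (n - 1)%N (n - 1)%N])
  /\
  (forall cN cG r : R, 0 < cN -> 0 < cG -> r = cG / cN ->
     (forall n : nat, (2 <= n)%N ->
        [/\ S_onion cN cG n
              = (n%:R + 4 * r - 2 / (n%:R - 1)) / (n%:R + 2 * r),
            S_vine cN cG n = (2 * r * n%:R) / (n%:R + 2 * r) &
            S_vine_tail cN cG n = ((1 + r) * n%:R) / (n%:R + 2 * r)])
     /\
     [/\ S_onion cN cG n @[n --> \oo] --> (1 : R),
         S_vine cN cG n @[n --> \oo] --> 2 * r &
         S_vine_tail cN cG n @[n --> \oo] --> 1 + r]).
Proof.
split=> [n eta n_ge2 _|cN cG _ cN_gt0 cG_gt0 ->].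
  have -> : ((n * (n - 1)) %/ 2 = 'C(n, 2))%N by rewrite bin2 subn1 divn2.
  split.
  - exact: makes_calls_extended_onion.
  - exact: makes_calls_c_vine_conventional.
  - exact: makes_calls_c_vine_tail.
  - exact: makes_calls_normalized_bartlett.
by split=> [n|]; [exact: speed_ratios|exact: cvg_speed_ratios].
Qed.
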